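(* Let $M>0$ and $\alpha\in(0,1]$. The class $\mathcal{P}_{\mathcal{H}}^0(\alpha,M)$ is closed under convex combinations; that is, if $f_1,\dots,f_n\in\mathcal{P}_{\mathcal{H}}^0(\alpha,M)$ and $t_1,\dots,t_n\in[0,1]$ with $\sum_{i=1}^n t_i=1$, then $\sum_{i=1}^n t_if_i\in\mathcal{P}_{\mathcal{H}}^0(\alpha,M)$.
   Context: $\mathbb{D}=\{z\in\mathbb{C}:|z|<1\}$. $\mathcal{H}$ is the class of complex-valued harmonic functions $f=h+\overline{g}$ in $\mathbb{D}$, with $h,g$ analytic in $\mathbb{D}$ and $h(0)=h'(0)-1=0$, $g(0)=0$. For $M>0$ and $\alpha\in(0,1]$, $\mathcal{P}_{\mathcal{H}}^0(\alpha,M)$ is the class of all $f=h+\overline{g}\in\mathcal{H}$ with $g'(0)=0$ and $$\mathrm{Re}\left((1-\alpha)h'(z)+\alpha zh''(z)\right)>-M+\left|(1-\alpha)g'(z)+\alpha zg''(z)\right|\quad\text{for all } z\in\mathbb{D}.$$ *)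

(* Defs.v *)
From Stdlib Require Import Reals.
From Coquelicot Require Import Coquelicot.
Open Scope R_scope.

Definition in_disk (z : C) : Prop := Cmod z < 1.

(* Functions on the disk are represented by total functions [C -> C]; every
   notion below only depends on their values in the (open) disk. *)

(* Analytic in the disk: locally the sum of a convergent complex power series. *)
Definition analytic_in_disk (h : C -> C) : Prop :=
  forall z0 : C, in_disk z0 ->
  exists (r : R) (a : nat -> C), 0 < r /\
    forall z : C, Cmod (z - z0)%C < r -> is_pseries a (z - z0)%C (h z).

(* [ex_diff_n u 2 x y] for all (x, y) in the disk says that [u] is of class
   C^2 there. *)
Definition real_harmonic_in_disk (u : R -> R -> R) : Prop :=
  forall x y : R, in_disk (x, y) ->
    ex_diff_n u 2 x y /\
    partial_derive 2 0 u x y + partial_derive 0 2 u x y = 0.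

Definition harmonic_in_disk (f : C -> C) : Prop :=
  real_harmonic_in_disk (fun x y => Re (f (x, y))) /\
  real_harmonic_in_disk (fun x y => Im (f (x, y))).

(* [f = h + conj g] is a decomposition witnessing that [f] is in the class H;
   for f in H such a pair (h, g) is unique in the disk, since g(0) = 0. *)
Definition H_decomposition (f h g : C -> C) : Prop :=
  analytic_in_disk h /\ analytic_in_disk g /\
  (forall z : C, in_disk z -> f z = (h z + Cconj (g z))%C) /\
  h (RtoC 0) = RtoC 0 /\ C_derive h (RtoC 0) = RtoC 1 /\
  g (RtoC 0) = RtoC 0.

(* [alpha_op alpha h z] is (1 - alpha) h'(z) + alpha z h''(z). *)
Definition alpha_op (alpha : R) (h : C -> C) (z : C) : C :=
  (RtoC (1 - alpha) * C_derive h z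
   + RtoC alpha * z * C_derive (C_derive h) z)%C.

Definition class_PH0 (alpha M : R) (f : C -> C) : Prop :=
  harmonic_in_disk f /\
  exists h g : C -> C,
    H_decomposition f h g /\
    C_derive g (RtoC 0) = RtoC 0 /\
    forall z : C, in_disk z ->
      Re (alpha_op alpha h z) > - M + Cmod (alpha_op alpha g z).

(* Main.v *)
(** The operator [alpha_op] is real-linear on analytic functions, so by the
    triangle inequality the defining inequality, made homogeneous by replacing
    [-M] with [-s M] where [s = h'(0)], cuts out a convex cone. The partial sums
    of the convex combination stay in this cone, and the full sum lands on the
    slice [s = 1]. Strictness is only claimed for [s > 0], which admits the empty
    sum.

    [C_derive] is a limit along the horizontal direction, hence a derivative of
    real functions of one real variable; on a horizontal line an analytic
    function is given by two real power series, which are smooth. *)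

Require Import Defs.
From Stdlib Require Import Reals Lra Lia FunctionalExtensionality.
From Coquelicot Require Import Coquelicot.
Open Scope R_scope.

(** * Openness of the disk, in the plane and along coordinate lines *)

Lemma in_disk_locally_2d (x y : R) :
  in_disk (x, y) -> locally_2d (fun u v => in_disk (u, v)) x y.
Proof.
  unfold in_disk; intros H.
  (* Half the distance to the unit circle: the two coordinate displacements then add up to less than
     the whole distance. *)
  assert (He : 0 < (1 - Cmod (x, y)) / 2) by lra.
  exists (mkposreal _ He); simpl; intros u v Hu Hv.
  replace (u, v) with ((x, y) + (RtoC (u - x)%R + (0, (v - y)%R)))%C
    by (unfold Cplus, RtoC; simpl; f_equal; ring).
  eapply Rle_lt_trans; [apply Cmod_triangle|].
  eapply Rle_lt_trans; [apply Rplus_le_compat_l, Cmod_triangle|].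
  rewrite Cmod_R.
  replace (Cmod (0, v - y)) with (Rabs (v - y)).
  - lra.
  - unfold Cmod; simpl; rewrite <- sqrt_Rsqr_abs; unfold Rsqr; f_equal; ring.
Qed.

Lemma locally_slice_1 (P : R -> R -> Prop) (x y : R) :
  locally_2d P x y -> locally x (fun u => P u y).
Proof.
  intros [d H]; exists d; intros u Hu.
  apply H; [exact Hu|].
  rewrite Rminus_diag, Rabs_R0; apply cond_pos.
Qed.

Lemma locally_slice_2 (P : R -> R -> Prop) (x y : R) :
  locally_2d P x y -> locally y (fun v => P x v).
Proof.
  intros [d H]; exists d; intros v Hv.
  apply H; [|exact Hv].
  rewrite Rminus_diag, Rabs_R0; apply cond_pos.
Qed.

Lemma in_disk_locally_1 (x y : R) :
  in_disk (x, y) -> locally x (fun u => in_disk (u, y)).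
Proof.
  intros H; apply (locally_slice_1 (fun u v => in_disk (u, v))).
  now apply in_disk_locally_2d.
Qed.

Lemma in_disk_locally_2 (x y : R) :
  in_disk (x, y) -> locally y (fun v => in_disk (x, v)).
Proof.
  intros H; apply (locally_slice_2 (fun u v => in_disk (u, v))).
  now apply in_disk_locally_2d.
Qed.

(** * Real-linear combinations of real harmonic functions *)

Lemma ex_derive_plus_scal (u v : R -> R) (t x : R) :
  ex_derive u x -> ex_derive v x -> ex_derive (fun z => u z + t * v z) x.
Proof.
  intros Hu Hv; apply (ex_derive_plus u (fun z => t * v z)); [exact Hu|].
  now apply ex_derive_scal.
Qed.

Lemma Derive_plus_scal (u v : R -> R) (t x : R) :
  ex_derive u x -> ex_derive v x ->
  Derive (fun z => u z + t * v z) x = Derive u x + t * Derive v x.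
Proof.
  intros Hu Hv; rewrite Derive_plus; [now rewrite Derive_scal|exact Hu|].
  now apply ex_derive_scal.
Qed.

(** The formula for the first derivative is itself differentiated, so it must hold on a
    neighbourhood of [x]; hence the [locally] hypotheses. *)
Lemma Derive_n_2_plus_scal (u v : R -> R) (t x : R) :
  locally x (ex_derive u) -> locally x (ex_derive v) ->
  ex_derive (Derive u) x -> ex_derive (Derive v) x ->
  Derive_n (fun z => u z + t * v z) 2 x
  = Derive_n u 2 x + t * Derive_n v 2 x.
Proof.
  intros Hu Hv Hu2 Hv2; simpl.
  rewrite <- Derive_plus_scal by assumption.
  apply Derive_ext_loc.
  generalize (filter_and _ _ Hu Hv); apply filter_imp.
  intros z [? ?]; now apply Derive_plus_scal.
Qed.

(** Induction on [n], passing from [u] and [v] to their first partial derivatives. Differentiability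
    is assumed on the whole disk because the partial derivatives of the combination have to split on
    a neighbourhood, not just at one point. *)
Lemma ex_diff_n_plus_scal (n : nat) (u v : R -> R -> R) (t x y : R) :
  (forall x y, in_disk (x, y) -> ex_diff_n u n x y) ->
  (forall x y, in_disk (x, y) -> ex_diff_n v n x y) ->
  in_disk (x, y) ->
  ex_diff_n (fun x y => u x y + t * v x y) n x y.
Proof.
  revert u v x y; induction n as [|n IH]; intros u v x y Hu Hv Hxy.
  - split; [|exact I].
    apply continuity_2d_pt_plus; [now apply Hu|].
    apply continuity_2d_pt_mult; [apply continuity_2d_pt_const|now apply Hv].
  - destruct (Hu x y Hxy) as (cu & u1 & u2 & _).
    destruct (Hv x y Hxy) as (cv & v1 & v2 & _).
    split; [|split; [|split; [|split]]].
    + apply continuity_2d_pt_plus; [exact cu|].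
      apply continuity_2d_pt_mult; [apply continuity_2d_pt_const|exact cv].
    + now apply ex_derive_plus_scal.
    + now apply ex_derive_plus_scal.
    + eapply ex_diff_n_ext_loc; [|apply (IH (fun a b => Derive (fun z => u z b) a)
        (fun a b => Derive (fun z => v z b) a)); [| |exact Hxy]].
      * generalize (in_disk_locally_2d x y Hxy); apply locally_2d_impl.
        apply locally_2d_forall; intros a b Hab; symmetry.
        destruct (Hu a b Hab) as (_ & ? & ? & _); destruct (Hv a b Hab) as (_ & ? & ? & _).
        now apply Derive_plus_scal.
      * intros a b Hab; apply Hu, Hab.
      * intros a b Hab; apply Hv, Hab.
    + eapply ex_diff_n_ext_loc; [|apply (IH (fun a b => Derive (fun z => u a z) b)
        (fun a b => Derive (fun z => v a z) b)); [| |exact Hxy]].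
      * generalize (in_disk_locally_2d x y Hxy); apply locally_2d_impl.
        apply locally_2d_forall; intros a b Hab; symmetry.
        destruct (Hu a b Hab) as (_ & ? & ? & _); destruct (Hv a b Hab) as (_ & ? & ? & _).
        now apply Derive_plus_scal.
      * intros a b Hab; apply Hu, Hab.
      * intros a b Hab; apply Hv, Hab.
Qed.

Lemma ex_diff_n_const (n : nat) (c x y : R) : ex_diff_n (fun _ _ => c) n x y.
Proof.
  revert c x y; induction n as [|n IH]; intros c x y.
  - split; [apply continuity_2d_pt_const|exact I].
  - split; [apply continuity_2d_pt_const|].
    split; [apply ex_derive_const|]. split; [apply ex_derive_const|].
    split; (apply ex_diff_n_ext_loc with (fun _ _ => 0);
      [apply locally_2d_forall; intros; now rewrite Derive_const|apply IH]).
Qed.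

Lemma real_harmonic_plus_scal (u v : R -> R -> R) (t : R) :
  real_harmonic_in_disk u -> real_harmonic_in_disk v ->
  real_harmonic_in_disk (fun x y => u x y + t * v x y).
Proof.
  intros Hu Hv x y Hxy; split.
  - apply ex_diff_n_plus_scal; [| |exact Hxy]; intros; [now apply Hu|now apply Hv].
  - destruct (Hu x y Hxy) as [du eu]; destruct (Hv x y Hxy) as [dv ev].
    unfold partial_derive in *.
    (* Each [partial_derive] here contains one derivative of order zero; reducing it leaves second
       derivatives of functions of one variable. *)
    change (Derive_n (fun a => u a y + t * v a y) 2 x
            + Derive_n (fun b => u x b + t * v x b) 2 y = 0).
    change (Derive_n (fun a => u a y) 2 x + Derive_n (u x) 2 y = 0) in eu.
    change (Derive_n (fun a => v a y) 2 x + Derive_n (v x) 2 y = 0) in ev.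
    rewrite !Derive_n_2_plus_scal.
    + transitivity ((Derive_n (fun a => u a y) 2 x + Derive_n (u x) 2 y)
        + t * (Derive_n (fun a => v a y) 2 x + Derive_n (v x) 2 y)); [ring|].
      rewrite eu, ev; ring.
    + generalize (in_disk_locally_2 x y Hxy); apply filter_imp; intros b Hb; apply (Hu _ _ Hb).
    + generalize (in_disk_locally_2 x y Hxy); apply filter_imp; intros b Hb; apply (Hv _ _ Hb).
    + apply du.
    + apply dv.
    + generalize (in_disk_locally_1 x y Hxy); apply filter_imp; intros b Hb; apply (Hu _ _ Hb).
    + generalize (in_disk_locally_1 x y Hxy); apply filter_imp; intros b Hb; apply (Hv _ _ Hb).
    + apply du.
    + apply dv.
Qed.

Lemma real_harmonic_const (c : R) : real_harmonic_in_disk (fun _ _ => c).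
Proof.
  intros x y _; split; [apply ex_diff_n_const|].
  unfold partial_derive; simpl.
  rewrite !(Derive_ext (Derive (fun _ => c)) (fun _ => 0))
    by (intros; apply Derive_const).
  rewrite !Derive_const; ring.
Qed.

Lemma harmonic_plus_scal (f k : C -> C) (t : R) :
  harmonic_in_disk f -> harmonic_in_disk k ->
  harmonic_in_disk (fun z => (f z + RtoC t * k z)%C).
Proof.
  intros [f1 f2] [k1 k2]; split.
  - replace (fun x y => Re (f (x, y) + RtoC t * k (x, y))%C)
      with (fun x y => Re (f (x, y)) + t * Re (k (x, y)))
      by (do 2 (apply functional_extensionality; intro); unfold Re; simpl; ring).
    now apply (real_harmonic_plus_scal (fun x y => Re (f (x, y)))
      (fun x y => Re (k (x, y)))).
  - replace (fun x y => Im (f (x, y) + RtoC t * k (x, y))%C)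
      with (fun x y => Im (f (x, y)) + t * Im (k (x, y)))
      by (do 2 (apply functional_extensionality; intro); unfold Im; simpl; ring).
    now apply (real_harmonic_plus_scal (fun x y => Im (f (x, y)))
      (fun x y => Im (k (x, y)))).
Qed.

(** * Complex derivatives along horizontal lines *)

(* No differentiability is needed: [Lim] is total and only samples its argument at
   [x0 + 1 / (n + 1)], where both difference quotients agree. *)
Lemma C_derive_horizontal (h : C -> C) (z : C) :
  C_derive h z = (Derive (fun x => fst (h (x, snd z))) (fst z),
                  Derive (fun x => snd (h (x, snd z))) (fst z)).
Proof.
  destruct z as [x0 y0]; unfold C_derive, C_lim, Derive, Lim; simpl.
  assert (Hn : forall n : nat, 0 < / (INR n + 1))
    by (intros n; apply Rinv_0_lt_compat; pose proof (pos_INR n); lra).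
  f_equal; f_equal; apply Lim_seq_ext; intros n;
    specialize (Hn n); set (d := / (INR n + 1)) in *; rewrite Rplus_0_l;
    field; repeat split; nra.
Qed.

(** The outer [C_derive] sees [C_derive h] only on the horizontal line through [z], and the
    first-order formula holds at each of its points. *)
Lemma C_derive_2_horizontal (h : C -> C) (z : C) :
  C_derive (C_derive h) z = (Derive_n (fun x => fst (h (x, snd z))) 2 (fst z),
                             Derive_n (fun x => snd (h (x, snd z))) 2 (fst z)).
Proof.
  rewrite C_derive_horizontal.
  f_equal; apply Derive_ext; intros x; now rewrite C_derive_horizontal.
Qed.

(** * Smoothness of analytic functions on horizontal lines *)

Lemma CV_radius_ge (a : nat -> R) (r : R) :
  (forall d, Rabs d < r -> ex_pseries a d) -> Rbar_le r (CV_radius a).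
Proof.
  intros H; apply Rbar_not_lt_le; intros Hlt.
  pose proof (CV_radius_ge_0 a) as H0.
  destruct (CV_radius a) as [c| |] eqn:E; simpl in *; try tauto.
  (* If the radius [c] were below [r], their midpoint would lie outside the disk of convergence, yet
     the series converges there and its terms tend to zero. *)
  assert (Hm : Rabs ((c + r) / 2) = (c + r) / 2) by (apply Rabs_pos_eq; lra).
  apply (CV_disk_outside a ((c + r) / 2)).
  - rewrite E, Hm; simpl; lra.
  - assert (Hs : ex_pseries a ((c + r) / 2)) by (apply H; rewrite Hm; lra).
    apply ex_pseries_R in Hs; now apply ex_series_lim_0.
Qed.

(** Here [p] stands for [fst] or [snd]. The powers of a real [d] are real, so a real-linear [p]
    commutes with the partial sums; the bound by [Cmod] carries convergence over to the images. *)
Lemma is_pseries_real_part (p : C -> R) (a : nat -> C) (d : R) (l : C) :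
  (forall z w, p (z + w)%C = p z + p w) ->
  (forall c z, p (RtoC c * z)%C = c * p z) ->
  (forall z, Rabs (p z) <= Cmod z) ->
  @is_pseries C_AbsRing C_NormedModule a (RtoC d) l ->
  is_pseries (fun n => p (a n)) d (p l).
Proof.
  intros Hplus Hscal Hle Hs.
  assert (Hpow : forall n, @pow_n C_AbsRing (RtoC d) n = RtoC (d ^ n)).
  { induction n as [|n IH]; [reflexivity|].
    simpl; rewrite IH; unfold mult; simpl; now rewrite <- RtoC_mult. }
  assert (Hsum : forall n,
    sum_n (fun k => scal (pow_n d k) (p (a k))) n
    = p (sum_n (fun k => @scal C_AbsRing C_NormedModule
                           (@pow_n C_AbsRing (RtoC d) k) (a k)) n)).
  { assert (Ht : forall k, scal (pow_n d k) (p (a k)) =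
      p (@scal C_AbsRing C_NormedModule (@pow_n C_AbsRing (RtoC d) k) (a k))).
    { intros k; rewrite Hpow, pow_n_pow; symmetry; apply Hscal. }
    induction n as [|n IH]; [rewrite !sum_O; apply Ht|].
    rewrite !sum_Sn, IH, Ht; symmetry; apply Hplus. }
  unfold is_pseries, is_series.
  apply filterlim_locally_ball_norm; intros eps.
  generalize (proj1 (filterlim_locally_ball_norm _ _) Hs eps).
  apply filter_imp; intros n Hn.
  unfold ball_norm in *; rewrite Hsum.
  eapply Rle_lt_trans; [|exact Hn].
  set (s := sum_n _ n).
  change (Rabs (p s - p l) <= Cmod (s - l)%C).
  replace (p s - p l) with (p (s - l)%C); [apply Hle|].
  (* The difference is put in a form to which additivity and real homogeneity of [p] apply. *)
  replace (s - l)%C with (s + RtoC (-1) * l)%C by ring.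
  rewrite Hplus, Hscal; ring.
Qed.

(** On a horizontal line the increment from the centre is real, so [p] composed with [h] is locally
    a real power series in [x - x0] of positive radius, which has derivatives of every order at its
    centre. *)
Lemma analytic_horizontal_smooth (p : C -> R) (h : C -> C) (x0 y0 : R) (n : nat) :
  (forall z w, p (z + w)%C = p z + p w) ->
  (forall c z, p (RtoC c * z)%C = c * p z) ->
  (forall z, Rabs (p z) <= Cmod z) ->
  analytic_in_disk h -> in_disk (x0, y0) ->
  ex_derive_n (fun x => p (h (x, y0))) n x0.
Proof.
  intros Hplus Hscal Hle Hh Hz.
  destruct (Hh _ Hz) as (r & a & Hr & Ha).
  assert (Hser : forall d, Rabs d < r ->
    is_pseries (fun n => p (a n)) d (p (h (x0 + d, y0)))).
  { intros d Hd; apply is_pseries_real_part; auto.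
    assert (E : (((x0 + d)%R, y0) - (x0, y0))%C = RtoC d)
      by (unfold Cminus, Cplus, Copp, RtoC; simpl; f_equal; ring).
    rewrite <- E; apply Ha; now rewrite E, Cmod_R. }
  assert (Hcv : Rbar_le r (CV_radius (fun n => p (a n)))).
  { apply CV_radius_ge; intros d Hd; eexists; now apply Hser. }
  apply ex_derive_n_ext_loc with (fun x => PSeries (fun n => p (a n)) (x + - x0)).
  - exists (mkposreal r Hr); intros x Hx.
    change (Rabs (x - x0) < r) in Hx.
    rewrite (is_pseries_unique _ _ _ (Hser (x + - x0) Hx)).
    do 3 f_equal; ring.
  - apply ex_derive_n_comp_trans.
    apply ex_derive_n_PSeries.
    rewrite Rplus_opp_r, Rabs_R0.
    now apply Rbar_lt_le_trans with r.
Qed.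

Lemma analytic_fst_smooth (h : C -> C) (x0 y0 : R) (n : nat) :
  analytic_in_disk h -> in_disk (x0, y0) ->
  ex_derive_n (fun x => fst (h (x, y0))) n x0.
Proof.
  apply (analytic_horizontal_smooth fst).
  - reflexivity.
  - intros c z; simpl; ring.
  - intros z; eapply Rle_trans; [apply Rmax_l|apply Rmax_Cmod].
Qed.

Lemma analytic_snd_smooth (h : C -> C) (x0 y0 : R) (n : nat) :
  analytic_in_disk h -> in_disk (x0, y0) ->
  ex_derive_n (fun x => snd (h (x, y0))) n x0.
Proof.
  apply (analytic_horizontal_smooth snd).
  - reflexivity.
  - intros c z; simpl; ring.
  - intros z; eapply Rle_trans; [apply Rmax_r|apply Rmax_Cmod].
Qed.

(** * Real-linear combinations of analytic functions, and [alpha_op] on them *)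

Lemma analytic_plus_scal (h k : C -> C) (t : R) :
  analytic_in_disk h -> analytic_in_disk k ->
  analytic_in_disk (fun z => (h z + RtoC t * k z)%C).
Proof.
  intros Hh Hk z0 Hz0.
  destruct (Hh z0 Hz0) as (r & a & Hr & Ha).
  destruct (Hk z0 Hz0) as (s & b & Hs & Hb).
  exists (Rmin r s), (PS_plus a (PS_scal (V := C_NormedModule) (RtoC t) b)).
  split; [now apply Rmin_pos|]; intros z Hz.
  apply (is_pseries_plus (V := C_NormedModule)).
  - apply Ha; eapply Rlt_le_trans; [exact Hz|apply Rmin_l].
  - apply (is_pseries_scal (V := C_NormedModule)); [apply Cmult_comm|].
    apply Hb; eapply Rlt_le_trans; [exact Hz|apply Rmin_r].
Qed.

Lemma analytic_zero : analytic_in_disk (fun _ => RtoC 0).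
Proof.
  intros z0 _; exists 1, (fun _ => RtoC 0); split; [lra|]; intros z _.
  unfold is_pseries, is_series.
  apply filterlim_ext with (fun _ : nat => RtoC 0); [|apply filterlim_const].
  induction x as [|n IH]; [rewrite sum_O|rewrite sum_Sn, <- IH];
    unfold scal, plus; simpl; unfold mult; simpl; ring.
Qed.

Lemma horizontal_plus_scal_fst (h k : C -> C) (t y : R) :
  (fun x => fst (h (x, y) + RtoC t * k (x, y))%C)
  = (fun x => fst (h (x, y)) + t * fst (k (x, y))).
Proof. apply functional_extensionality; intro; simpl; ring. Qed.

Lemma horizontal_plus_scal_snd (h k : C -> C) (t y : R) :
  (fun x => snd (h (x, y) + RtoC t * k (x, y))%C)
  = (fun x => snd (h (x, y)) + t * snd (k (x, y))).
Proof. apply functional_extensionality; intro; simpl; ring. Qed.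

Lemma C_derive_plus_scal (h k : C -> C) (t : R) (z : C) :
  analytic_in_disk h -> analytic_in_disk k -> in_disk z ->
  C_derive (fun z => (h z + RtoC t * k z)%C) z
  = (C_derive h z + RtoC t * C_derive k z)%C.
Proof.
  destruct z as [x y]; intros Hh Hk Hz.
  rewrite !C_derive_horizontal; cbn [fst snd].
  rewrite horizontal_plus_scal_fst, horizontal_plus_scal_snd.
  rewrite !Derive_plus_scal.
  - unfold Cplus, Cmult; simpl; f_equal; ring.
  (* [ex_derive_n] of order 1 is convertible to [ex_derive] of the function itself. *)
  - now apply (analytic_snd_smooth h x y 1).
  - now apply (analytic_snd_smooth k x y 1).
  - now apply (analytic_fst_smooth h x y 1).
  - now apply (analytic_fst_smooth k x y 1).
Qed.

Lemma C_derive_2_plus_scal (h k : C -> C) (t : R) (z : C) :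
  analytic_in_disk h -> analytic_in_disk k -> in_disk z ->
  C_derive (C_derive (fun z => (h z + RtoC t * k z)%C)) z
  = (C_derive (C_derive h) z + RtoC t * C_derive (C_derive k) z)%C.
Proof.
  destruct z as [x y]; intros Hh Hk Hz.
  rewrite !C_derive_2_horizontal; cbn [fst snd].
  rewrite horizontal_plus_scal_fst, horizontal_plus_scal_snd.
  pose proof (in_disk_locally_1 x y Hz) as Hloc.
  rewrite !Derive_n_2_plus_scal.
  - unfold Cplus, Cmult; cbn [fst snd RtoC]; f_equal; ring.
  - revert Hloc; apply filter_imp; intros a Ha; now apply (analytic_snd_smooth h a y 1).
  - revert Hloc; apply filter_imp; intros a Ha; now apply (analytic_snd_smooth k a y 1).
  - now apply (analytic_snd_smooth h x y 2).
  - now apply (analytic_snd_smooth k x y 2).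
  - revert Hloc; apply filter_imp; intros a Ha; now apply (analytic_fst_smooth h a y 1).
  - revert Hloc; apply filter_imp; intros a Ha; now apply (analytic_fst_smooth k a y 1).
  - now apply (analytic_fst_smooth h x y 2).
  - now apply (analytic_fst_smooth k x y 2).
Qed.

Lemma alpha_op_plus_scal (alpha : R) (h k : C -> C) (t : R) (z : C) :
  analytic_in_disk h -> analytic_in_disk k -> in_disk z ->
  alpha_op alpha (fun z => (h z + RtoC t * k z)%C) z
  = (alpha_op alpha h z + RtoC t * alpha_op alpha k z)%C.
Proof.
  intros Hh Hk Hz; unfold alpha_op.
  rewrite C_derive_plus_scal, C_derive_2_plus_scal by assumption; ring.
Qed.

(** * The cone over the class *)

Definition cone_PH0 (alpha M s : R) (f : C -> C) : Prop :=
  harmonic_in_disk f /\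
  exists h g : C -> C,
    analytic_in_disk h /\ analytic_in_disk g /\
    (forall z, in_disk z -> f z = (h z + Cconj (g z))%C) /\
    h (RtoC 0) = RtoC 0 /\ C_derive h (RtoC 0) = RtoC s /\
    g (RtoC 0) = RtoC 0 /\ C_derive g (RtoC 0) = RtoC 0 /\
    forall z, in_disk z ->
      - (s * M) + Cmod (alpha_op alpha g z) <= Re (alpha_op alpha h z) /\
      (0 < s -> - (s * M) + Cmod (alpha_op alpha g z) < Re (alpha_op alpha h z)).

Lemma cone_PH0_1 (alpha M : R) (f : C -> C) :
  cone_PH0 alpha M 1 f <-> class_PH0 alpha M f.
Proof.
  unfold cone_PH0, class_PH0, H_decomposition; split.
  - intros (Hf & h & g & Hh & Hg & E & h0 & h1 & g0 & g1 & H).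
    split; [exact Hf|]; exists h, g; repeat (split; [tauto|]).
    intros z Hz; destruct (H z Hz) as [_ H1]; specialize (H1 Rlt_0_1); lra.
  - intros (Hf & h & g & D & g1 & H).
    split; [exact Hf|]; exists h, g; repeat (split; [tauto|]).
    intros z Hz; specialize (H z Hz); split; intros; lra.
Qed.

Lemma cone_PH0_0 (alpha M : R) : cone_PH0 alpha M 0 (fun _ => RtoC 0).
Proof.
  (* An equality of functions, so that it also rewrites inside the iterated [C_derive]. *)
  assert (D0 : C_derive (fun _ => RtoC 0) = (fun _ => RtoC 0)).
  { apply functional_extensionality; intros z.
    rewrite C_derive_horizontal; simpl; now rewrite !Derive_const. }
  assert (A0 : forall z, alpha_op alpha (fun _ => RtoC 0) z = RtoC 0)
    by (intros z; unfold alpha_op; rewrite !D0; ring).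
  split; [split; apply (real_harmonic_const 0)|].
  exists (fun _ => RtoC 0), (fun _ => RtoC 0).
  split; [apply analytic_zero|]. split; [apply analytic_zero|].
  split; [intros z _; unfold Cconj, Cplus, RtoC; simpl; f_equal; ring|].
  rewrite D0; repeat (split; [reflexivity|]).
  intros z _; rewrite !A0, Cmod_0; simpl; split; intros; lra.
Qed.

Lemma cone_PH0_plus_scal (alpha M s t : R) (f k : C -> C) :
  0 <= s -> 0 <= t -> cone_PH0 alpha M s f -> cone_PH0 alpha M 1 k ->
  cone_PH0 alpha M (s + t) (fun z => (f z + RtoC t * k z)%C).
Proof.
  intros Hs Ht (Hf & h & g & Hh & Hg & E & h0 & h1 & g0 & g1 & H)
    (Hk & h' & g' & Hh' & Hg' & E' & h0' & h1' & g0' & g1' & H').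
  assert (D0 : in_disk (RtoC 0)) by (unfold in_disk; rewrite Cmod_0; lra).
  split; [now apply harmonic_plus_scal|].
  exists (fun z => (h z + RtoC t * h' z)%C), (fun z => (g z + RtoC t * g' z)%C).
  split; [now apply analytic_plus_scal|]. split; [now apply analytic_plus_scal|].
  split.
  { intros z Hz; rewrite E, E' by exact Hz.
    (* Conjugation commutes with the factor [t] because [t] is real. *)
    unfold Cconj, Cplus, Cmult, RtoC; simpl; f_equal; ring. }
  rewrite !C_derive_plus_scal by assumption.
  split; [rewrite h0, h0'; ring|].
  split; [rewrite h1, h1', RtoC_plus; ring|].
  split; [rewrite g0, g0'; ring|].
  split; [rewrite g1, g1'; ring|].
  intros z Hz; rewrite !alpha_op_plus_scal by assumption.
  destruct (H z Hz) as [Hle Hlt]; destruct (H' z Hz) as [_ Hlt'].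
  specialize (Hlt' Rlt_0_1).
  assert (HC : Cmod (alpha_op alpha g z + RtoC t * alpha_op alpha g' z)%C
    <= Cmod (alpha_op alpha g z) + t * Cmod (alpha_op alpha g' z)).
  { eapply Rle_trans; [apply Cmod_triangle|].
    rewrite Cmod_mult, Cmod_R, (Rabs_pos_eq t) by exact Ht; lra. }
  replace (Re (alpha_op alpha h z + RtoC t * alpha_op alpha h' z)%C)
    with (Re (alpha_op alpha h z) + t * Re (alpha_op alpha h' z))
    by (unfold Re; simpl; ring).
  (* For [0 < s] strictness comes from [f]. For [s = 0] the sum [s + t] is positive only if [t] is,
     and then the strict inequality of [k] survives scaling by [t]. *)
  split; [nra|]; intros Hst.
  destruct (Rle_lt_or_eq_dec 0 s Hs) as [Hs'|<-]; [specialize (Hlt Hs'); nra|nra].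
Qed.

Theorem theorem3p1 (M alpha : R) (hM : 0 < M) (halpha : 0 < alpha <= 1)
    (n : nat) (f : nat -> C -> C) (t : nat -> R)
    (hf : forall i : nat, (1 <= i <= n)%nat -> class_PH0 alpha M (f i))
    (ht : forall i : nat, (1 <= i <= n)%nat -> 0 <= t i <= 1)
    (hsum : sum_n_m t 1 n = 1) :
  class_PH0 alpha M (fun z : C => sum_n_m (fun i => (RtoC (t i) * f i z)%C) 1 n).
Proof.
  (* Nonnegativity of the partial weight is carried along because adding the next term in the cone
     requires it. *)
  assert (Hind : forall m, (m <= n)%nat ->
    0 <= sum_n_m t 1 m /\
    cone_PH0 alpha M (sum_n_m t 1 m)
      (fun z : C => sum_n_m (fun i => (RtoC (t i) * f i z)%C) 1 m)).
  { induction m as [|m IH]; intros Hm.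
    - rewrite sum_n_m_zero by lia.
      (* The range from 1 to 0 is empty, so the induction starts from the zero function at the apex
         of the cone. *)
      split; [apply Rle_refl|].
      replace (fun z : C => sum_n_m (fun i => (RtoC (t i) * f i z)%C) 1 0)
        with (fun _ : C => RtoC 0); [apply cone_PH0_0|].
      apply functional_extensionality; intros z.
      rewrite sum_n_m_zero by lia; reflexivity.
    - destruct IH as [Hpos Hcone]; [lia|].
      assert (Htm : 0 <= t (S m) <= 1) by (apply ht; lia).
      rewrite sum_n_Sm by lia.
      split; [apply Rplus_le_le_0_compat; [exact Hpos|lra]|].
      replace (fun z : C => sum_n_m (fun i => (RtoC (t i) * f i z)%C) 1 (S m))
        with (fun z : C => (sum_n_m (fun i => (RtoC (t i) * f i z)%C) 1 m
                            + RtoC (t (S m)) * f (S m) z)%C).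
      + apply cone_PH0_plus_scal; [exact Hpos|lra|exact Hcone|].
        apply cone_PH0_1, hf; lia.
      + apply functional_extensionality; intros z.
        rewrite sum_n_Sm by lia; reflexivity. }
  (* Reading [hsum] backwards turns the slice at 1 into the slice at the total weight. *)
  apply cone_PH0_1; rewrite <- hsum; now apply Hind.
Qed.
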